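(* Let $n\ge 1$, $N\ge 1$, let $X_1,\dots,X_N\in GL(n)$ be invertible $n\times n$ matrices, and let $m_1,\dots,m_N$ be integers. If $\sum_{i=1}^N m_i>n$, then $$Z_{m_1,\dots,m_N}(X_1,\dots,X_N)=0.$$
   Context: Matrices have entries in $\mathbb{R}$ or $\mathbb{C}$, and $I$ is the $n\times n$ identity matrix. For $n\times n$ matrices $X_1,\dots,X_N$, the generalized matrix invariants $Z_{m_1,\dots,m_N}(X_1,\dots,X_N)$ are the coefficients in the polynomial expansion, in the scalar commuting variables $\alpha_1,\dots,\alpha_N$, $$\det\Big(I+\sum_{i=1}^N\alpha_iX_i\Big)=\sum_{m_1,\dots,m_N}\alpha_1^{m_1}\cdots\alpha_N^{m_N}\,Z_{m_1,\dots,m_N}(X_1,\dots,X_N),$$ where the sum is taken over all $(m_1,\dots,m_N)\in\mathbb{Z}^N$, with $Z_{m_1,\dots,m_N}(X_1,\dots,X_N):=0$ whenever the monomial $\alpha_1^{m_1}\cdots\alpha_N^{m_N}$ does not appear in the expansion (in particular whenever some $m_i<0$). *)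

(* Defs.v *)
From HB Require Import structures.
From mathcomp Require Import all_boot all_order all_algebra.
From mathcomp Require Import complex reals.
From mathcomp Require Import mpoly.

Set Implicit Arguments.
Unset Strict Implicit.
Unset Printing Implicit Defensive.

Import GRing.Theory Num.Theory.
Local Open Scope ring_scope.

Section GeneralizedInvariants.
Variables (K : comNzRingType) (n N : nat).
Implicit Types (X : 'I_N -> 'M[K]_n) (m : 'I_N -> int).

(* The scalar variables alpha_i are the formal indeterminates 'X_i, so the
   determinant is taken over the polynomial ring {mpoly K[N]}. *)
Definition det_expansion X : {mpoly K[N]} :=
  \det (1%:M + \sum_(i < N) 'X_i *: map_mx (@mpolyC N K) (X i)).

(* The exponents range over all integers; the value is 0 as soon as one of
   them is negative. *)
Definition geninv X m : K :=
  if [forall i, 0 <= m i]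
  then (det_expansion X)@_[multinom absz (m i) | i < N]
  else 0.

End GeneralizedInvariants.

(* Main.v *)
(** Every entry of [1 + \sum_i 'X_i X_i] has degree at most 1 in the
    indeterminates, so the Leibniz formula bounds the total degree of the
    determinant by n. *)

Require Import Defs.
From mathcomp Require Import all_boot all_order all_algebra.
From mathcomp Require Import complex reals.
From mathcomp Require Import mpoly.

Import Order.TTheory GRing.Theory Num.Theory.
Local Open Scope ring_scope.

(** The expansion has total degree at most [n] in the indeterminates ([msize_det_expansion]), so no
    monomial of degree above [n] occurs in it. Degrees are measured by [msize], which is the degree
    plus one, and 0 for the zero polynomial. *)

(** Each monomial of [p * q] is a product of monomials of [p] and [q]. Successor bounds make degrees
    add without a predecessor or a separate zero case. *)
Lemma msizeM_leS (K : nzRingType) (N d e : nat) (p q : {mpoly K[N]}) :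
  (msize p <= d.+1)%N -> (msize q <= e.+1)%N -> (msize (p * q) <= (d + e).+1)%N.
Proof.
move=> sp sq; rewrite msizeE; apply/bigmax_leqP_seq => m /msuppM_le.
case/allpairsP=> -[m1 m2] /= [m1p m2q ->] _; rewrite mdegD ltnS leq_add //.
  by rewrite -ltnS (leq_trans (msize_mdeg_lt m1p)).
by rewrite -ltnS (leq_trans (msize_mdeg_lt m2q)).
Qed.

Lemma msizeD_leq {K : nzRingType} {N d : nat} {p q : {mpoly K[N]}} :
  (msize p <= d)%N -> (msize q <= d)%N -> (msize (p + q) <= d)%N.
Proof. by move=> sp sq; rewrite (leq_trans (msizeD_le p q)) // geq_max sp. Qed.

Lemma msize_sum_leq {K : nzRingType} {N d : nat} {I : Type} (r : seq I)
    (P : pred I) (F : I -> {mpoly K[N]}) :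
  (forall i, P i -> (msize (F i) <= d)%N) ->
  (msize (\sum_(i <- r | P i) F i) <= d)%N.
Proof.
move=> sF; elim/big_ind: _ => //; first by rewrite msize0.
by move=> p q; apply: msizeD_leq.
Qed.

Lemma msize_det_leq {K : comNzRingType} {N n : nat} (A : 'M[{mpoly K[N]}]_n) :
  (forall i j, (msize (A i j) <= 2)%N) -> (msize (\det A) <= n.+1)%N.
Proof.
move=> sA; apply: msize_sum_leq => s _.
rewrite mulr_sign; case: ifP => _; rewrite ?mmeasureN.
(* Writing [n] as a sum of ones over ['I_n] lets one induction run along the product and its bound:
   each factor raises the degree by at most 1. *)
all: rewrite -[n in n.+1]card_ord -sum1_card.
all: elim/big_rec2: _ => [|i d p _ sp]; first by rewrite msize1.
all: exact: msizeM_leS.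
Qed.

Lemma msize_det_expansion {K : comNzRingType} {n N : nat} (X : 'I_N -> 'M[K]_n) :
  (msize (det_expansion X) <= n.+1)%N.
Proof.
apply: msize_det_leq => i j; rewrite mxE; apply: msizeD_leq.
  by rewrite mxE; case: eqP => _; rewrite ?msize1 ?msize0.
rewrite summxE; apply: msize_sum_leq => k _; rewrite !mxE mulrC mul_mpolyC.
by rewrite (leq_trans (msizeZ_le _ _)) // msizeX mdeg1.
Qed.

Lemma geninv_eq0 {K : comNzRingType} {n N : nat} (X : 'I_N -> 'M[K]_n)
    (m : 'I_N -> int) :
  \sum_(i < N) m i > n%:Z -> geninv X m = 0.
Proof.
move=> hm; rewrite /geninv; case: ifP => // /forallP m_ge0.
(* All exponents are nonnegative here, so it remains to see that the monomial has degree at least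
   [n.+1]; [absz] is then harmless and [hm] transfers from integers to naturals. *)
apply/memN_msupp_eq0/msize_mdeg_ge/(leq_trans (msize_det_expansion X)).
rewrite mdegE -ltz_nat -[ltRHS]natz natr_sum.
under eq_bigr => i _ do rewrite mnmE natz gez0_abs //.
by [].
Qed.

Theorem mainTheorem2 (R : realType) (n N : nat) (hn : (1 <= n)%N)
    (hN : (1 <= N)%N) (m : 'I_N -> int) (hm : \sum_(i < N) m i > n%:Z) :
  (forall X : 'I_N -> 'M[R]_n,
     (forall i, X i \in unitmx) -> geninv X m = 0) /\
  (forall X : 'I_N -> 'M[complex R]_n,
     (forall i, X i \in unitmx) -> geninv X m = 0).
Proof. by split=> X _; apply: geninv_eq0. Qed.
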